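(* Let $(\mathbf{d}^-,\mathbf{d}^+)\neq\mathbf{0}$ be an orientation, with $\mathbf{d}^-\in\mathbb{R}^m$, $\mathbf{d}^+\in\mathbb{R}^s$ non-negative, and let $\rho^*(\mathbf{x},\mathbf{y})$ be a function on $P$ given by either of the Farrell oriented efficiencies $\rho^*_{\mathrm{L}}(\mathbf{x},\mathbf{y})$ or $\rho^*_{\mathrm{Q}}(\mathbf{x},\mathbf{y})$ defined in the context. Then $$\frac{\partial \rho^*}{\partial x_i}(\mathbf{x},\mathbf{y})\leq 0\qquad\text{and}\qquad \frac{\partial \rho^*}{\partial y_r}(\mathbf{x},\mathbf{y})\geq 0$$ for $i=1,\ldots,m$ and $r=1,\ldots,s$.
   Context: Fix positive integers $m,s,n$ and strictly positive data matrices $X=(x_{ij})\in\mathbb{R}_{>0}^{m\times n}$, $Y=(y_{rj})\in\mathbb{R}_{>0}^{s\times n}$ (inputs and outputs of $n$ reference decision-making units, DMUs). Inequalities between vectors are component-wise. The production possibility set under constant returns to scale is $$P=\{(\mathbf{x},\mathbf{y})\in\mathbb{R}_{>0}^{m+s} : X\boldsymbol{\lambda}\le \mathbf{x},\ \mathbf{y}\le Y\boldsymbol{\lambda}\text{ for some }\boldsymbol{\lambda}\in\mathbb{R}^n,\ \boldsymbol{\lambda}\ge\mathbf{0}\}.$$ For $(\mathbf{x},\mathbf{y})\in P$ define: (Linear oriented model) $\beta^*_{\mathrm{L}}(\mathbf{x},\mathbf{y})$ is the maximum of $\beta$ over all $\beta\ge 0$, $\boldsymbol{\lambda}\ge\mathbf{0}$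 with $\sum_{j=1}^n\lambda_jx_{ij}-(1-\beta d^-_i)x_i\le 0$ for $i=1,\ldots,m$ and $\sum_{j=1}^n\lambda_jy_{rj}-(1+\beta d^+_r)y_r\ge 0$ for $r=1,\ldots,s$. (Quadratic-CRS oriented model) $\beta^*_{\mathrm{Q}}(\mathbf{x},\mathbf{y})$ is the maximum of $\beta$ over all $\beta\ge 0$, $\boldsymbol{\lambda}\ge\mathbf{0}$ with $\beta d^+_r<1$ for $r=1,\ldots,s$, $\sum_{j=1}^n\lambda_jx_{ij}-(1-\beta d^-_i)x_i\le 0$ for $i=1,\ldots,m$ and $\sum_{j=1}^n\lambda_jy_{rj}-\frac{1}{1-\beta d^+_r}\,y_r\ge 0$ for $r=1,\ldots,s$. The corresponding Farrell oriented efficiencies are $$\rho^*_{\mathrm{L}}(\mathbf{x},\mathbf{y})=\frac{1-\beta^*_{\mathrm{L}}(\mathbf{x},\mathbf{y})\frac1m\sum_{i=1}^m d^-_i}{1+\beta^*_{\mathrm{L}}(\mathbf{x},\mathbf{y})\frac1s\sum_{r=1}^s d^+_r},\qquad \rho^*_{\mathrm{Q}}(\mathbf{x},\mathbf{y})=\frac{1-\beta^*_{\mathrm{Q}}(\mathbf{x},\mathbf{y})\frac1m\sum_{i=1}^m d^-_i}{\frac1s\sum_{r=1}^s \frac{1}{1-\beta^*_{\mathrm{Q}}(\mathbf{x},\mathbf{y})d^+_r}}.$$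
   Formalization: The efficiencies can have kinks where a partial derivative does not exist; the signs are proved at every point of P for each partial derivative that exists, taken relative to P (one-sided at boundary points). *)

(* Defs.v *)
From HB Require Import structures.
From mathcomp Require Import all_boot all_order all_algebra.
From mathcomp Require Import all_classical all_reals all_analysis.
Import Order.TTheory GRing.Theory Num.Theory.
Import numFieldNormedType.Exports.

Set Implicit Arguments.
Unset Strict Implicit.
Unset Printing Implicit Defensive.

Local Open Scope classical_set_scope.
Local Open Scope ring_scope.

(* A point (x, y) of R^(m+s) is a pair of column vectors; it is read in P as an
   activity with inputs x and outputs y, and all vector inequalities are
   component-wise. *)
Definition production_set (R : realType) (m s n : nat)
    (X : 'M[R]_(m, n)) (Y : 'M[R]_(s, n)) : set ('cV[R]_m * 'cV[R]_s) :=
  [set p : 'cV[R]_m * 'cV[R]_s |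
             [/\ forall i, 0 < p.1 i 0,
               forall r, 0 < p.2 r 0 &
               exists lam : 'cV[R]_n,
                 [/\ forall j, 0 <= lam j 0,
                     forall i, (X *m lam) i 0 <= p.1 i 0 &
                     forall r, p.2 r 0 <= (Y *m lam) r 0]]].

(* The greatest element of A, with default 0 if there is none.  For X, Y > 0,
   y > 0 and (dm, dp) <> 0 nonnegative, the sets of feasible beta below are
   compact, so at points of [production_set] the maximum is attained. *)
Definition maximum (R : realType) (A : set R) : R := xget 0 (A `&` ubound A).

Definition feasibleL (R : realType) (m s n : nat)
    (X : 'M[R]_(m, n)) (Y : 'M[R]_(s, n)) (dm : 'cV[R]_m) (dp : 'cV[R]_s)
    (p : 'cV[R]_m * 'cV[R]_s) (beta : R) (lam : 'cV[R]_n) : Prop :=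
  [/\ 0 <= beta,
      forall j, 0 <= lam j 0,
      forall i, \sum_j lam j 0 * X i j - (1 - beta * dm i 0) * p.1 i 0 <= 0 &
      forall r, 0 <= \sum_j lam j 0 * Y r j - (1 + beta * dp r 0) * p.2 r 0].

Definition feasibleQ (R : realType) (m s n : nat)
    (X : 'M[R]_(m, n)) (Y : 'M[R]_(s, n)) (dm : 'cV[R]_m) (dp : 'cV[R]_s)
    (p : 'cV[R]_m * 'cV[R]_s) (beta : R) (lam : 'cV[R]_n) : Prop :=
  [/\ 0 <= beta,
      forall j, 0 <= lam j 0,
      forall r, beta * dp r 0 < 1,
      forall i, \sum_j lam j 0 * X i j - (1 - beta * dm i 0) * p.1 i 0 <= 0 &
      forall r, 0 <= \sum_j lam j 0 * Y r j - 1 / (1 - beta * dp r 0) * p.2 r 0].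

Definition betaL (R : realType) (m s n : nat)
    (X : 'M[R]_(m, n)) (Y : 'M[R]_(s, n)) (dm : 'cV[R]_m) (dp : 'cV[R]_s)
    (p : 'cV[R]_m * 'cV[R]_s) : R :=
  maximum [set beta | exists lam, feasibleL X Y dm dp p beta lam].

Definition betaQ (R : realType) (m s n : nat)
    (X : 'M[R]_(m, n)) (Y : 'M[R]_(s, n)) (dm : 'cV[R]_m) (dp : 'cV[R]_s)
    (p : 'cV[R]_m * 'cV[R]_s) : R :=
  maximum [set beta | exists lam, feasibleQ X Y dm dp p beta lam].

Definition rhoL (R : realType) (m s n : nat)
    (X : 'M[R]_(m, n)) (Y : 'M[R]_(s, n)) (dm : 'cV[R]_m) (dp : 'cV[R]_s)
    (p : 'cV[R]_m * 'cV[R]_s) : R :=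
  (1 - betaL X Y dm dp p * (1 / m%:R * \sum_i dm i 0)) /
  (1 + betaL X Y dm dp p * (1 / s%:R * \sum_r dp r 0)).

Definition rhoQ (R : realType) (m s n : nat)
    (X : 'M[R]_(m, n)) (Y : 'M[R]_(s, n)) (dm : 'cV[R]_m) (dp : 'cV[R]_s)
    (p : 'cV[R]_m * 'cV[R]_s) : R :=
  (1 - betaQ X Y dm dp p * (1 / m%:R * \sum_i dm i 0)) /
  (1 / s%:R * \sum_r (1 / (1 - betaQ X Y dm dp p * dp r 0))).

(* [f] has derivative [l] along [v] at [a], as a function on the domain [A]: the
   increments are restricted to those that stay in [A].  At interior points of
   [A] this is the two-sided derivative [derive] of the library; at points of
   [A] from which only one side is accessible along [v] it is the one-sided
   derivative. *)
Definition has_derive_in (R : realType) (V : lmodType R) (A : set V)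
    (f : V -> R) (a v : V) (l : R) : Prop :=
  h^-1 * (f (h *: v + a) - f a)
    @[h --> within [set h : R | A (h *: v + a)] 0^'] --> l.

Definition has_partial_x (R : realType) (m s : nat)
    (A : set ('cV[R]_m * 'cV[R]_s)) (f : 'cV[R]_m * 'cV[R]_s -> R)
    (p : 'cV[R]_m * 'cV[R]_s) (i : 'I_m) (l : R) : Prop :=
  has_derive_in A f p (delta_mx i 0, 0) l.

Definition has_partial_y (R : realType) (m s : nat)
    (A : set ('cV[R]_m * 'cV[R]_s)) (f : 'cV[R]_m * 'cV[R]_s -> R)
    (p : 'cV[R]_m * 'cV[R]_s) (r : 'I_s) (l : R) : Prop :=
  has_derive_in A f p (0, delta_mx r 0) l.

(* Main.v *)
Require Import Defs.
From HB Require Import structures.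
From mathcomp Require Import all_boot all_order all_algebra.
From mathcomp Require Import all_classical all_reals all_analysis.
From mathcomp Require Import ring.
Import Order.TTheory GRing.Theory Num.Theory.
Import numFieldNormedType.Exports.

(** Efficiency can only drop when a unit uses more input or makes less output.
    Write [dominates p p'] when [p'] has at least the inputs and at most the
    outputs of [p].  Every step and weight vector feasible at [p] is
    feasible at [p']
    ([feasibleL_mono], [feasibleQ_mono]), so the optimal step [beta] at [p'] is
    at least the one at [p].  Each efficiency is a quotient whose nonnegative
    numerator is nonincreasing in [beta] and whose positive denominator is
    nondecreasing; hence it is antitone for [dominates] ([rhoL_antitone],
    [rhoQ_antitone]).  The signs of the partial derivatives follow from this
    antitonicity by looking at increments of one sign only
    ([partials_of_antitone]), which also covers the boundary points of the
    production set.

    The comparison of the optimal steps needs the maxima to be attained, for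
    otherwise [maximum] would return its default value.  This is a compactness
    argument ([program_max]): the feasible pairs of a step and a weight vector
    form a closed set; the positive inputs bound the weights, and a nonzero
    orientation bounds the step ([betaL_max], [betaQ_max]). *)

Set Implicit Arguments.
Unset Strict Implicit.
Unset Printing Implicit Defensive.

Local Open Scope classical_set_scope.
Local Open Scope ring_scope.

(** * One-sided difference quotients *)

Lemma quotient_cvg_filter (R : realType) (V : lmodType R) (A : set V)
    (f : V -> R) (a v : V) (l : R) (F : set_system R) :
  ProperFilter F -> F --> 0^' -> (\forall h \near F, A (h *: v + a)) ->
  has_derive_in A f a v l ->
  h^-1 * (f (h *: v + a) - f a) @[h --> F] --> l.
Proof.
move=> PF F0 FA; apply: cvg_trans; apply: cvg_app => P /= /F0.
by move=> FP; near=> h; apply: (near FP h) => //; near: h.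
Unshelve. all: by end_near. Qed.

(** The sign of a derivative can be read off one side only: the increments from
    that side form a smaller proper filter, so the difference quotient still
    tends to [l] along it. *)
Lemma has_derive_in_le0 (R : realType) (V : lmodType R) (A : set V)
    (f : V -> R) (a v : V) (l : R) :
  (\forall h \near 0^'+, A (h *: v + a) /\ f (h *: v + a) <= f a) ->
  has_derive_in A f a v l -> l <= 0.
Proof.
move=> near_le fl.
have quot_l : h^-1 * (f (h *: v + a) - f a) @[h --> 0^'+] --> l.
  apply: quotient_cvg_filter fl.
    move=> P; apply: (filterS (F := nbhs (0 : R))) => h Ph h_gt0.
    by apply: Ph; rewrite gt_eqF.
  by apply: filterS near_le => h [].
apply: (cvgr_to_le quot_l).
near=> h; have h_gt0 : 0 < h by near: h; exact: nbhs_right_gt.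
have [_ le_fa] : A (h *: v + a) /\ f (h *: v + a) <= f a by near: h.
by rewrite pmulr_rle0 ?invr_gt0 // subr_le0.
Unshelve. all: by end_near. Qed.

Lemma has_derive_in_ge0 (R : realType) (V : lmodType R) (A : set V)
    (f : V -> R) (a v : V) (l : R) :
  (\forall h \near 0^'-, A (h *: v + a) /\ f (h *: v + a) <= f a) ->
  has_derive_in A f a v l -> 0 <= l.
Proof.
move=> near_le fl.
have quot_l : h^-1 * (f (h *: v + a) - f a) @[h --> 0^'-] --> l.
  apply: quotient_cvg_filter fl.
    move=> P; apply: (filterS (F := nbhs (0 : R))) => h Ph h_lt0.
    by apply: Ph; rewrite lt_eqF.
  by apply: filterS near_le => h [].
apply: (cvgr_to_ge quot_l).
near=> h; have h_lt0 : h < 0 by near: h; exact: nbhs_left_lt.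
have [_ le_fa] : A (h *: v + a) /\ f (h *: v + a) <= f a by near: h.
by rewrite nmulr_rge0 ?invr_lt0 // subr_le0.
Unshelve. all: by end_near. Qed.

(** * Attained maxima *)

Lemma maximumP (R : realType) (A : set R) :
  (exists2 b, A b & ubound A b) -> A (maximum A) /\ ubound A (maximum A).
Proof. by case=> b Ab bA; apply: (xgetPex 0 (P := A `&` ubound A)); exists b. Qed.

Lemma closed_superlevel (R : realType) (T : topologicalType) (I : Type)
    (G : I -> T -> R) :
  (forall i, continuous (G i)) -> closed [set z | forall i, 0 <= G i z].
Proof.
move=> cG.
have -> : [set z | forall i, 0 <= G i z] =
    \bigcap_(i in setT) (G i @^-1` [set u | 0 <= u]).
  by apply/seteqP; split => z /= Gz i => [_|]; exact: Gz.
apply: closed_bigI => i _; apply: preimage_closed; last exact: closed_ge.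
by move=> z _; exact: cG.
Qed.

Lemma fst_continuous (R : realType) (n : nat) :
  continuous (fun z : R * 'rV[R]_n => z.1).
Proof. by move=> z; exact: cvg_fst. Qed.

Lemma snd_coord_continuous (R : realType) (n : nat) (j : 'I_n) :
  continuous (fun z : R * 'rV[R]_n => z.2 0 j).
Proof.
move=> z; apply: (continuous_comp (f := snd) (g := fun v : 'rV[R]_n => v 0 j)).
  exact: cvg_snd.
exact: coord_continuous.
Qed.

Lemma weighted_sum_continuous (R : realType) (n : nat) (c : 'I_n -> R) :
  continuous (fun z : R * 'rV[R]_n => \sum_j z.2 0 j * c j).
Proof.
apply: continuous_big => [|j _]; first exact: add_continuous.
by move=> z; apply: cvgM; [exact: snd_coord_continuous|exact: cvg_cst].
Qed.

(** The positive input coefficients bound the weights: a single term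
    [lam j * c j] is at most the whole sum. *)
Lemma weight_le (R : realType) (n : nat) (c lam : 'I_n -> R) (t : R) :
  (forall j, 0 < c j) -> (forall j, 0 <= lam j) ->
  \sum_j lam j * c j <= t -> forall j, lam j <= t / c j.
Proof.
move=> c_gt0 lam_ge0 le_t j; rewrite ler_pdivlMr //; apply: le_trans le_t.
by rewrite (bigD1 j) //= lerDl sumr_ge0 // => k _; rewrite mulr_ge0 // ltW.
Qed.

(** At a feasible step the inputs [X *m lam] are nonnegative, and the positive
    inputs [x] contracted by the factors [t = 1 - beta * dm i 0] lie above
    them; so these factors are nonnegative. *)
Lemma contraction_ge0 (R : realType) (n : nat) (c lam : 'I_n -> R) (t u : R) :
  (forall j, 0 < c j) -> (forall j, 0 <= lam j) -> 0 < u ->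
  \sum_j lam j * c j <= t * u -> 0 <= t.
Proof.
move=> c_gt0 lam_ge0 u_gt0 le_tu; rewrite -(pmulr_lge0 _ u_gt0).
by apply: le_trans le_tu; apply: sumr_ge0 => j _; rewrite mulr_ge0 // ltW.
Qed.

(** The step and the weights are maximized over jointly: the feasible pairs
    form a compact set, as a closed part of a box, while the set of feasible
    steps alone is only a projection of it. *)
Lemma max_fst_attained (R : realType) (n : nat) (S : set (R * 'rV[R]_n))
    (b : R) (c : 'I_n -> R) :
  closed S -> S !=set0 ->
  (forall z, S z -> 0 <= z.1 <= b) ->
  (forall z, S z -> forall j, 0 <= z.2 0 j <= c j) ->
  exists2 z, S z & forall t, S t -> t.1 <= z.1.
Proof.
move=> S_closed S0 Sb Sc.
pose box : set (R * 'rV[R]_n) :=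
  `[0, b] `*` [set v : 'rV[R]_n | forall j, `[0, c j]%classic (v ord0 j)].
have box_compact : compact box.
  apply: compact_setX; first exact: segment_compact.
  apply: (@rV_compact _ _ (fun j => `[0, c j]%classic)) => j.
  exact: segment_compact.
have S_compact : compact S.
  apply: (subclosed_compact S_closed box_compact) => z Sz.
  by split=> [|j] /=; rewrite in_itv /=; [exact: Sb|exact: Sc].
have [|z /set_mem Sz z_max] := compact_EVT_max (f := fst) S0 S_compact.
  by apply: continuous_subspaceT => z; exact: fst_continuous.
by exists z => // t St; apply: z_max; rewrite inE.
Qed.

(** * The common shape of the two models *)

(** Both models have these constraints on the pairs (step, weights), with
    output constraints [0 <= G r z] for some continuous [G].  The weights form
    a row vector because [rV_compact] speaks of boxes of row vectors. *)
Definition program (R : realType) (m s n : nat) (X : 'M[R]_(m, n))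
    (dm x : 'cV[R]_m) (G : 'I_s -> R * 'rV[R]_n -> R) : set (R * 'rV[R]_n) :=
  [set z : R * 'rV[R]_n |
    [/\ 0 <= z.1,
        forall j, 0 <= z.2 0 j,
        forall i, \sum_j z.2 0 j * X i j <= (1 - z.1 * dm i 0) * x i 0 &
        forall r, 0 <= G r z]].

Section Program.
Context (R : realType) (m s n : nat) (X : 'M[R]_(m, n)) (dm x : 'cV[R]_m).
Context (G : 'I_s -> R * 'rV[R]_n -> R).
Hypothesis m_gt0 : (0 < m)%N.
Hypothesis X_gt0 : forall i j, 0 < X i j.
Hypothesis dm_ge0 : forall i, 0 <= dm i 0.
Hypothesis x_gt0 : forall i, 0 < x i 0.

Let S := program X dm x G.

Lemma closed_program : (forall r, continuous (G r)) -> closed S.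
Proof.
move=> cG.
(* The index type [unit] casts the single constraint on the step in the form
   of [closed_superlevel]. *)
have -> : S = [set z : R * 'rV[R]_n | forall u : unit, 0 <= z.1] `&`
    [set z : R * 'rV[R]_n | forall j, 0 <= z.2 0 j] `&`
    [set z : R * 'rV[R]_n | forall i,
      0 <= (1 - z.1 * dm i 0) * x i 0 - \sum_j z.2 0 j * X i j] `&`
    [set z : R * 'rV[R]_n | forall r, 0 <= G r z].
  apply/seteqP; split => z.
    case=> z1 z2 zX zG; split=> //; split; first by split.
    by move=> i; rewrite subr_ge0.
  case=> [[[/(_ tt) z1 z2] zX] zG]; split=> // i.
  by rewrite -subr_ge0; exact: zX.
apply: closedI; last exact: closed_superlevel.
apply: closedI; [apply: closedI|]; apply: closed_superlevel.
- by move=> _; exact: fst_continuous.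
- by move=> j; exact: snd_coord_continuous.
- move=> i z; apply: cvgB; last exact: weighted_sum_continuous.
  apply: cvgM; last exact: cvg_cst.
  apply: cvgB; first exact: cvg_cst.
  by apply: cvgM; [exact: fst_continuous|exact: cvg_cst].
Qed.

Lemma program_weight_le z i : S z -> forall j, 0 <= z.2 0 j <= x i 0 / X i j.
Proof.
case=> z1_ge0 z2_ge0 zX _ j; rewrite z2_ge0 /=.
apply: (weight_le (c := X i) (lam := z.2 0)) => //; apply: le_trans (zX i) _.
by rewrite ler_piMl ?(ltW (x_gt0 i)) // lerBlDr lerDl mulr_ge0.
Qed.

Lemma program_slack_ge0 z i : S z -> 0 <= 1 - z.1 * dm i 0.
Proof.
case=> _ z2_ge0 zX _.
exact: (contraction_ge0 (c := X i) (lam := z.2 0) _ _ (x_gt0 i) (zX i)).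
Qed.

Lemma program_max (b : R) :
  (forall r, continuous (G r)) -> S !=set0 -> (forall z, S z -> z.1 <= b) ->
  exists2 z, S z & forall t, S t -> t.1 <= z.1.
Proof.
move=> cG S0 Sb; pose i : 'I_m := Ordinal m_gt0.
apply: (max_fst_attained (b := b) (c := fun j => x i 0 / X i j)) => //.
- exact: closed_program.
- by move=> z Sz; rewrite Sb // andbT; case: Sz.
- by move=> z Sz j; exact: program_weight_le.
Qed.
End Program.

(** * Attainment of the optimal steps *)

Section Models.
Context (R : realType) (m s n : nat).
Context (X : 'M[R]_(m, n)) (Y : 'M[R]_(s, n)) (dm : 'cV[R]_m) (dp : 'cV[R]_s).
Hypothesis m_gt0 : (0 < m)%N.
Hypothesis s_gt0 : (0 < s)%N.
Hypothesis X_gt0 : forall i j, 0 < X i j.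
Hypothesis Y_gt0 : forall r j, 0 < Y r j.
Hypothesis dm_ge0 : forall i, 0 <= dm i 0.
Hypothesis dp_ge0 : forall r, 0 <= dp r 0.
Hypothesis d_neq0 : (dm, dp) <> (0, 0).

Let P := production_set X Y.
Implicit Types (p : 'cV[R]_m * 'cV[R]_s) (beta : R) (lam : 'cV[R]_n).

(** A positive component of the orientation bounds the step.  For an input
    component this is the nonnegativity of the contracted input; the bound from
    an output component depends on the model. *)
Lemma program_bounded (x : 'cV[R]_m) (G : 'I_s -> R * 'rV[R]_n -> R) :
  (forall i, 0 < x i 0) ->
  (forall r, 0 < dp r 0 ->
    exists b, forall z, program X dm x G z -> z.1 <= b) ->
  exists b, forall z, program X dm x G z -> z.1 <= b.
Proof.
move=> x_gt0 dp_bound.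
have [[i dmi]|dm0] := pselect (exists i, 0 < dm i 0).
  exists (dm i 0)^-1 => z /(program_slack_ge0 X_gt0 x_gt0 i).
  by rewrite subr_ge0 -ler_pdivlMr // mul1r.
have [[r dpr]|dp0] := pselect (exists r, 0 < dp r 0); first exact: dp_bound dpr.
case: d_neq0; congr pair; apply/colP => k; rewrite mxE; apply/eqP;
  rewrite eq_le ?dm_ge0 ?dp_ge0 andbT leNgt; apply/negP => ?.
- by apply: dm0; exists k.
- by apply: dp0; exists k.
Qed.

Definition output_slackL (y : 'cV[R]_s) (r : 'I_s) (z : R * 'rV[R]_n) : R :=
  \sum_j z.2 0 j * Y r j - (1 + z.1 * dp r 0) * y r 0.

(** The output constraint of the quadratic model cleared of its denominator;
    unlike the original it is continuous, and closed, across [beta * dp r 0 = 1].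
    See [feasibleQ_program]. *)
Definition output_slackQ (y : 'cV[R]_s) (r : 'I_s) (z : R * 'rV[R]_n) : R :=
  (1 - z.1 * dp r 0) * (\sum_j z.2 0 j * Y r j) - y r 0.

Lemma continuous_output_slackL y r : continuous (output_slackL y r).
Proof.
move=> z; apply: cvgB; first exact: weighted_sum_continuous.
apply: cvgM; last exact: cvg_cst.
apply: cvgD; first exact: cvg_cst.
by apply: cvgM; [exact: fst_continuous|exact: cvg_cst].
Qed.

Lemma continuous_output_slackQ y r : continuous (output_slackQ y r).
Proof.
move=> z; apply: cvgB; last exact: cvg_cst.
apply: cvgM; last exact: weighted_sum_continuous.
apply: cvgB; first exact: cvg_cst.
by apply: cvgM; [exact: fst_continuous|exact: cvg_cst].
Qed.

Lemma outputs_ge0 lam r : (forall j, 0 <= lam j 0) ->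
  0 <= \sum_j lam j 0 * Y r j.
Proof. by move=> lam_ge0; apply: sumr_ge0 => j _; rewrite mulr_ge0 // ltW. Qed.

Lemma feasibleL_program p beta lam :
  feasibleL X Y dm dp p beta lam <->
  program X dm p.1 (output_slackL p.2) (beta, lam^T).
Proof.
rewrite /program /output_slackL /=.
have sumT (c : 'I_n -> R) : \sum_j lam^T 0 j * c j = \sum_j lam j 0 * c j.
  by apply: eq_bigr => j _; rewrite mxE.
split=> -[beta_ge0 lam_ge0 lamX lamY]; split=> // k.
- by rewrite mxE.
- by rewrite sumT -subr_le0.
- by rewrite sumT.
- by have := lam_ge0 k; rewrite mxE.
- by rewrite subr_le0 -sumT.
- by rewrite -sumT.
Qed.

(** The strict inequality [beta * dp r 0 < 1], which is not a closed condition,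
    is absorbed by the cleared output constraint: since the outputs [Y *m lam]
    are nonnegative and [p.2] is positive,
    [p.2 <= (1 - beta * dp r 0) * (Y *m lam)] makes the factor positive. *)
Lemma feasibleQ_program p beta lam : (forall r, 0 < p.2 r 0) ->
  feasibleQ X Y dm dp p beta lam <->
  program X dm p.1 (output_slackQ p.2) (beta, lam^T).
Proof.
move=> y_gt0; rewrite /program /output_slackQ /=.
have sumT (c : 'I_n -> R) : \sum_j lam^T 0 j * c j = \sum_j lam j 0 * c j.
  by apply: eq_bigr => j _; rewrite mxE.
have slackE r : 0 < 1 - beta * dp r 0 ->
    (0 <= \sum_j lam j 0 * Y r j - 1 / (1 - beta * dp r 0) * p.2 r 0) =
    (0 <= (1 - beta * dp r 0) * (\sum_j lam j 0 * Y r j) - p.2 r 0).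
  by move=> slack_gt0; rewrite !subr_ge0 mul1r mulrC ler_pdivrMr // [leRHS]mulrC.
split=> [[beta_ge0 lam_ge0 dp_lt1 lamX lamY]|[beta_ge0 lam_ge0 lamX lamY]].
  split=> // k.
  - by rewrite mxE.
  - by rewrite sumT -subr_le0.
  - by rewrite sumT -slackE // subr_gt0.
have {}lam_ge0 j : 0 <= lam j 0 by have := lam_ge0 j; rewrite mxE.
have slack_gt0 r : 0 < 1 - beta * dp r 0.
  have := lamY r; rewrite sumT subr_ge0 => /(lt_le_trans (y_gt0 r)).
  have := outputs_ge0 r lam_ge0; rewrite le_eqVlt => /orP[/eqP <-|lamYr_gt0].
    by rewrite mulr0 ltxx.
  by rewrite pmulr_lgt0.
split=> // k.
- by rewrite -subr_gt0.
- by rewrite subr_le0 -sumT.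
- by rewrite slackE // -sumT.
Qed.

(** What the two models share in proving that [betaL] and [betaQ] are attained:
    each has to provide an equivalent [program], a bound on the step from an
    output component of the orientation, and feasibility of the step 0. *)
Lemma program_max_transpose (x : 'cV[R]_m) (G : 'I_s -> R * 'rV[R]_n -> R)
    (feasible : R -> 'cV[R]_n -> Prop) :
  (forall i, 0 < x i 0) -> (forall r, continuous (G r)) ->
  (forall beta lam, feasible beta lam <-> program X dm x G (beta, lam^T)) ->
  (forall r, 0 < dp r 0 ->
    exists b, forall z, program X dm x G z -> z.1 <= b) ->
  (exists lam, feasible 0 lam) ->
  let A := [set beta | exists lam, feasible beta lam] in
  (exists lam, feasible (maximum A) lam) /\
  forall beta lam, feasible beta lam -> beta <= maximum A.
Proof.
move=> x_gt0 cG feasibleE dp_bound [lam0 lam0F] A.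
have [b Sb] := program_bounded x_gt0 dp_bound.
have [|[beta v] Sz z_max] := program_max m_gt0 X_gt0 dm_ge0 x_gt0 cG _ Sb.
  by exists (0, lam0^T); apply/feasibleE.
have [] := @maximumP R A; last first.
  by move=> AA A_max; split=> // t lam tF; apply: A_max; exists lam.
exists beta; first by exists v^T; apply/feasibleE; rewrite trmxK.
by move=> t [lam /feasibleE/z_max].
Qed.

Lemma feasibleL0 p : P p -> exists lam, feasibleL X Y dm dp p 0 lam.
Proof.
case=> _ _ [lam [lam_ge0 lamX lamY]]; exists lam.
have mulC k (Z : 'M[R]_(k, n)) i :
    \sum_j lam j 0 * Z i j = (Z *m lam) i 0.
  by rewrite mxE; apply: eq_bigr => j _; rewrite mulrC.
by split=> // k; rewrite mul0r ?subr0 ?addr0 mul1r mulC ?subr_le0 ?subr_ge0.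
Qed.

Lemma feasibleQ0 p : P p -> exists lam, feasibleQ X Y dm dp p 0 lam.
Proof.
move=> /feasibleL0[lam [_ lam_ge0 lamX lamY]]; exists lam; split=> // r.
  by rewrite mul0r.
by have := lamY r; rewrite !mul0r addr0 subr0 divr1.
Qed.

Lemma betaL_max p : P p ->
  (exists lam, feasibleL X Y dm dp p (betaL X Y dm dp p) lam) /\
  forall beta lam, feasibleL X Y dm dp p beta lam -> beta <= betaL X Y dm dp p.
Proof.
move=> Pp; have [x_gt0 y_gt0 _] := Pp.
apply: (program_max_transpose (G := output_slackL p.2) x_gt0).
- exact: continuous_output_slackL.
- exact: feasibleL_program.
- move=> r dpr; pose i : 'I_m := Ordinal m_gt0.
  (* The bounds [p.1 i 0 / X i j] on the weights cap the [r]-th output, hence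
     the expanded output [(1 + beta * dp r 0) * p.2 r 0]. *)
  exists ((\sum_j p.1 i 0 / X i j * Y r j) / (dp r 0 * p.2 r 0)) => z Sz.
  rewrite ler_pdivlMr ?mulr_gt0 // mulrA.
  have [_ _ _ /(_ r)] := Sz; rewrite subr_ge0 mulrDl mul1r => le_lamY.
  apply: le_trans (_ : _ <= \sum_j z.2 0 j * Y r j) _.
    by apply: le_trans le_lamY; rewrite lerDr ltW.
  apply: ler_sum => j _; rewrite ler_wpM2r ?(ltW (Y_gt0 r j)) //.
  by have /andP[] := program_weight_le X_gt0 dm_ge0 x_gt0 i Sz j.
- exact: feasibleL0.
Qed.

Lemma betaQ_max p : P p ->
  (exists lam, feasibleQ X Y dm dp p (betaQ X Y dm dp p) lam) /\
  forall beta lam, feasibleQ X Y dm dp p beta lam -> beta <= betaQ X Y dm dp p.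
Proof.
move=> Pp; have [x_gt0 y_gt0 _] := Pp.
have feasibleE beta lam := feasibleQ_program beta lam y_gt0.
apply: (program_max_transpose (G := output_slackQ p.2) x_gt0) => //.
- exact: continuous_output_slackQ.
(* The step is bounded by the constraint [beta * dp r 0 < 1] itself. *)
- move=> r dpr; exists (dp r 0)^-1 => -[beta v] Sz.
  have /feasibleE[_ _ /(_ r) + _ _] :
      program X dm p.1 (output_slackQ p.2) (beta, v^T^T) by rewrite trmxK.
  by rewrite -ltr_pdivlMr // mul1r => /ltW.
- exact: feasibleQ0.
Qed.

(** * Monotonicity of the efficiencies *)

Lemma input_factor_ge0 p beta lam i : P p -> (forall j, 0 <= lam j 0) ->
  \sum_j lam j 0 * X i j - (1 - beta * dm i 0) * p.1 i 0 <= 0 ->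
  0 <= 1 - beta * dm i 0.
Proof.
case=> x_gt0 _ _ lam_ge0; rewrite subr_le0 => lamX.
exact: (contraction_ge0 (c := X i) (lam := fun j => lam j 0) _ _ (x_gt0 i) lamX).
Qed.

(** Enlarging an input relaxes its constraint because the factor in front of
    it is nonnegative at a feasible step. *)
Lemma input_constraint_mono p p' beta lam i : P p -> (forall j, 0 <= lam j 0) ->
  p.1 i 0 <= p'.1 i 0 ->
  \sum_j lam j 0 * X i j - (1 - beta * dm i 0) * p.1 i 0 <= 0 ->
  \sum_j lam j 0 * X i j - (1 - beta * dm i 0) * p'.1 i 0 <= 0.
Proof.
move=> Pp lam_ge0 le_x lamX; have slack := input_factor_ge0 Pp lam_ge0 lamX.
by apply: le_trans lamX; rewrite lerB // ler_wpM2l.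
Qed.

Definition dominates p p' : Prop :=
  (forall i, p.1 i 0 <= p'.1 i 0) /\ (forall r, p'.2 r 0 <= p.2 r 0).

Lemma feasibleL_mono p p' beta lam : P p -> dominates p p' ->
  feasibleL X Y dm dp p beta lam -> feasibleL X Y dm dp p' beta lam.
Proof.
move=> Pp [le_x le_y] [beta_ge0 lam_ge0 lamX lamY]; split=> // [i|r].
  exact: input_constraint_mono (le_x i) (lamX i).
by apply: le_trans (lamY r) _; rewrite lerB // ler_wpM2l // addr_ge0 // mulr_ge0.
Qed.

Lemma feasibleQ_mono p p' beta lam : P p -> dominates p p' ->
  feasibleQ X Y dm dp p beta lam -> feasibleQ X Y dm dp p' beta lam.
Proof.
move=> Pp [le_x le_y] [beta_ge0 lam_ge0 dp_lt1 lamX lamY]; split=> // [i|r].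
  exact: input_constraint_mono (le_x i) (lamX i).
apply: le_trans (lamY r) _; rewrite lerB // ler_wpM2l // mul1r invr_ge0.
by rewrite subr_ge0 ltW.
Qed.

(** The numerator of both efficiencies is the mean of the factors
    [1 - beta * dm i 0]. *)
Lemma mean_factor_ge0 beta : (forall i, 0 <= 1 - beta * dm i 0) ->
  0 <= 1 - beta * (1 / m%:R * \sum_i dm i 0).
Proof.
move=> slack; have m_neq0 : (m%:R : R) != 0 by rewrite pnatr_eq0 -lt0n.
suff -> : 1 - beta * (1 / m%:R * \sum_i dm i 0) =
    m%:R^-1 * \sum_i (1 - beta * dm i 0).
  by rewrite mulr_ge0 ?invr_ge0 ?ler0n // sumr_ge0.
rewrite big_split /= sumr_const card_ord sumrN -mulr_sumr.
by field.
Qed.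

Lemma ler_ratio (num num' den den' : R) :
  0 <= num' -> num' <= num -> 0 < den -> den <= den' -> num' / den' <= num / den.
Proof.
move=> num'_ge0 le_num den_gt0 le_den.
have den'_gt0 := lt_le_trans den_gt0 le_den.
by apply: ler_pM => //; [rewrite invr_ge0 ltW|rewrite lef_pV2].
Qed.

Lemma mean_ge0 k (d : 'cV[R]_k) : (forall i, 0 <= d i 0) ->
  0 <= 1 / k%:R * \sum_i d i 0.
Proof. by move=> d_ge0; rewrite mulr_ge0 ?divr_ge0 ?sumr_ge0. Qed.

(** A point dominated by [p] leaves at least as much room for improvement, so
    its optimal step is no smaller; increasing the step does not raise the
    numerator of the efficiency and does not lower its denominator. *)
Lemma rhoL_antitone p p' : P p -> P p' -> dominates p p' ->
  rhoL X Y dm dp p' <= rhoL X Y dm dp p.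
Proof.
move=> Pp Pp' pp'; have [[lam lamF] _] := betaL_max Pp.
have [[lam' lamF'] beta'_max] := betaL_max Pp'.
have le_beta := beta'_max _ _ (feasibleL_mono Pp pp' lamF).
have [beta_ge0 _ _ _] := lamF; have [_ lam'_ge0 lamX' _] := lamF'.
apply: ler_ratio.
- by apply: mean_factor_ge0 => i; exact: input_factor_ge0 (lamX' i).
- by rewrite lerB // ler_wpM2r // mean_ge0.
- by rewrite ltr_wpDr // mulr_ge0 // mean_ge0.
- by rewrite lerD // ler_wpM2r // mean_ge0.
Qed.

Lemma rhoQ_antitone p p' : P p -> P p' -> dominates p p' ->
  rhoQ X Y dm dp p' <= rhoQ X Y dm dp p.
Proof.
move=> Pp Pp' pp'; have [[lam lamF] _] := betaQ_max Pp.
have [[lam' lamF'] beta'_max] := betaQ_max Pp'.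
have le_beta := beta'_max _ _ (feasibleQ_mono Pp pp' lamF).
have [_ _ dp_lt1 _ _] := lamF; have [_ lam'_ge0 dp_lt1' lamX' _] := lamF'.
apply: ler_ratio.
- by apply: mean_factor_ge0 => i; exact: input_factor_ge0 (lamX' i).
- by rewrite lerB // ler_wpM2r // mean_ge0.
- rewrite mulr_gt0 ?divr_gt0 ?ltr0n //; pose r0 : 'I_s := Ordinal s_gt0.
  rewrite (bigD1 r0) //= ltr_pwDl ?divr_gt0 ?subr_gt0 // sumr_ge0 // => r _.
  by rewrite divr_ge0 // subr_ge0 ltW.
- rewrite ler_wpM2l ?divr_ge0 //; apply: ler_sum => r _.
  by rewrite !mul1r lef_pV2 ?posrE ?subr_gt0 // lerB // ler_wpM2r.
Qed.

(** * Signs of the partial derivatives *)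

Lemma production_set_dominated p p' : P p -> dominates p p' ->
  (forall r, 0 < p'.2 r 0) -> P p'.
Proof.
case=> x_gt0 _ [lam [lam_ge0 lamX lamY]] [le_x le_y] y'_gt0; split=> //.
  by move=> i; exact: lt_le_trans (le_x i).
exists lam; split=> // k; first exact: le_trans (le_x k).
exact: le_trans (lamY k).
Qed.

(** From any point of [P], raising an input or slightly lowering an output
    stays in [P] and gives a dominated point.  The first move is an increment
    [h > 0], the second one [h < 0]; this explains the opposite signs. *)
Lemma partials_of_antitone (rho : 'cV[R]_m * 'cV[R]_s -> R)
    (x : 'cV[R]_m) (y : 'cV[R]_s) :
  (forall p p', P p -> P p' -> dominates p p' -> rho p' <= rho p) ->
  P (x, y) ->
  (forall i l, has_partial_x P rho (x, y) i l -> l <= 0) /\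
  (forall r l, has_partial_y P rho (x, y) r l -> 0 <= l).
Proof.
move=> rho_antitone xyP; have [_ y_gt0 _] := xyP; split=> k l.
  apply: has_derive_in_le0; near=> h.
  have h_gt0 : 0 < h by near: h; exact: nbhs_right_gt.
  have dom : dominates (x, y) (h *: (delta_mx k 0, 0) + (x, y)).
    split=> j /=; rewrite !mxE ?mulr0 ?add0r // lerDr.
    by rewrite mulr_ge0 // ltW.
  have P' : P (h *: (delta_mx k 0, 0) + (x, y)).
    apply: (production_set_dominated xyP dom) => r /=.
    by rewrite !mxE mulr0 add0r; exact: y_gt0.
  by split=> //; exact: rho_antitone.
apply: has_derive_in_ge0; near=> h.
have h_lt0 : h < 0 by near: h; exact: nbhs_left_lt.
have y_h : - y k 0 < h.
  by near: h; apply: nbhs_left_gt; rewrite oppr_lt0; exact: y_gt0.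
have dom : dominates (x, y) (h *: (0, delta_mx k 0) + (x, y)).
  split=> j /=; rewrite !mxE ?mulr0 ?add0r // gerDr.
  by rewrite mulr_le0_ge0 // ltW.
have P' : P (h *: (0, delta_mx k 0) + (x, y)).
  apply: (production_set_dominated xyP dom) => r /=; rewrite !mxE /=.
  have [->|_] := eqVneq r k; last by rewrite mulr0 add0r; exact: y_gt0.
  by rewrite mulr1 -ltrBlDr sub0r.
by split=> //; exact: rho_antitone.
Unshelve. all: by end_near. Qed.

End Models.

Unset Implicit Arguments.

Theorem proposition5p2 (R : realType) (m s n : nat)
    (m_gt0 : (0 < m)%N) (s_gt0 : (0 < s)%N) (n_gt0 : (0 < n)%N)
    (X : 'M[R]_(m, n)) (Y : 'M[R]_(s, n))
    (X_gt0 : forall i j, 0 < X i j) (Y_gt0 : forall r j, 0 < Y r j)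
    (dm : 'cV[R]_m) (dp : 'cV[R]_s)
    (dm_ge0 : forall i, 0 <= dm i 0) (dp_ge0 : forall r, 0 <= dp r 0)
    (d_neq0 : (dm, dp) <> (0, 0))
    (rho : 'cV[R]_m * 'cV[R]_s -> R)
    (rhoE : (forall p, production_set X Y p -> rho p = rhoL X Y dm dp p) \/
            (forall p, production_set X Y p -> rho p = rhoQ X Y dm dp p))
    (x : 'cV[R]_m) (y : 'cV[R]_s) (xyP : production_set X Y (x, y)) :
  (forall (i : 'I_m) (l : R),
     has_partial_x (production_set X Y) rho (x, y) i l -> l <= 0) /\
  (forall (r : 'I_s) (l : R),
     has_partial_y (production_set X Y) rho (x, y) r l -> 0 <= l).
Proof.
apply: (partials_of_antitone _ xyP).
case: rhoE => rhoE p p' Pp Pp' pp'; rewrite !rhoE //.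
- exact: (rhoL_antitone m_gt0 X_gt0 Y_gt0 dm_ge0 dp_ge0 d_neq0 Pp Pp' pp').
- exact: (rhoQ_antitone m_gt0 s_gt0 X_gt0 Y_gt0 dm_ge0 dp_ge0 d_neq0 Pp Pp' pp').
Qed.
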